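(* Let $G_1,G_2,G_k$ be generators over $\Sigma_1,\Sigma_2,\Sigma_k$, respectively, with $\Sigma_1\cap\Sigma_2\subseteq\Sigma_k\subseteq\Sigma_1\cup\Sigma_2$ and $L(G_k)\subseteq P_k(L(G_1))\parallel P_k(L(G_2))$; put $L=L(G_1\|G_2\|G_k)$. Let $K\subseteq L_m(G_1\| G_2\| G_k)$ be a specification such that both $K$ and its prefix closure $\overline{K}$ are conditionally decomposable with respect to $\Sigma_1,\Sigma_2,\Sigma_k$. Define \[ \sup C_k=\sup C(P_k(K),L(G_k),\Sigma_{k,u}),\qquad \sup C_{i+k}=\sup C\big(P_{i+k}(K),\,L(G_i)\parallel\overline{\sup C_k},\,\Sigma_{i+k,u}\big),\quad i=1,2. \] Assume that $\sup C_{1+k}$ and $\sup C_{2+k}$ are nonconflicting. Assume that, for $i=1,2$, the projection $P^{i+k}_k:(\Sigma_i\cup\Sigma_k)^*\to\Sigma_k^*$ is a $(P^{i+k}_i)^{-1}(L(G_i))$-observer, and that either for both $i=1,2$ it is OCC for $(P^{i+k}_i)^{-1}(L(G_i))$, or for both $i=1,2$ it is LCC for $(P^{i+k}_i)^{-1}(L(G_i))$. Then \[ \sup C_{1+k}\parallel\sup C_{2+k}=\sup cC\big(K,L,(\Sigma_{1,u},\Sigma_{2,u},\Sigma_{k,u})\big). \]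
   Context: An event set is a finite nonempty set $\Sigma$; a language over $\Sigma$ is a subset of the set $\Sigma^*$ of finite words, and the specification $K$ is a regular language. $\overline{L}$ denotes the prefix closure of $L$. A generator over $\Sigma$ is $G=(Q,\Sigma,f,q_0,Q_m)$ with finite nonempty state set $Q$, partial transition function $f:Q\times\Sigma\to Q$ (extended to words), initial state $q_0$, marked states $Q_m\subseteq Q$; $L(G)=\{s\in\Sigma^*: f(q_0,s)\text{ is defined}\}$ and $L_m(G)=\{s\in\Sigma^*: f(q_0,s)\in Q_m\}$. For $\Sigma_0\subseteq\Sigma$, the projection $\Sigma^*\to\Sigma_0^*$ is the homomorphism erasing events outside $\Sigma_0$ and fixing those in $\Sigma_0$. For $L_i\subseteq\Sigma_i^*$, $L_1\parallel L_2=\{w\in(\Sigma_1\cup\Sigma_2)^*: P_i(w)\in L_i,\ i=1,2\}$, where $P_i$ is the projection to $\Sigma_i^*$. $G_1\|G_2$ is the parallel composition of generators, with $L(G_1\|G_2)=L(G_1)\parallel L(G_2)$ and $L_m(G_1\|G_2)=L_m(G_1)\parallel L_m(G_2)$. Languages $L_1,L_2$ are nonconflicting if $\overline{L_1\parallel L_2}=\overline{L_1}\parallel\overline{L_2}$. The set $\Sigma_1\cup\Sigma_2$ is partitioned into controllable events $\Sigma_c$ and uncontrollable events $\Sigma_u$. Notation, for $i=1,2$: $\Sigma_{i+k}=\Sigma_i\cup\Sigma_k$; $\Sigma_{j,u}=\Sigma_j\cap\Sigma_u$ for $j\in\{1,2,k,1+k,2+k\}$; $P_k:(\Sigma_1\cup\Sigma_2)^*\to\Sigma_k^*$,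 $P_{i+k}:(\Sigma_1\cup\Sigma_2)^*\to\Sigma_{i+k}^*$, $P^{i+k}_k:\Sigma_{i+k}^*\to\Sigma_k^*$ and $P^{i+k}_i:\Sigma_{i+k}^*\to\Sigma_i^*$ are projections. $P_k(L(G_i))$ is regarded as a language over $\Sigma_i\cap\Sigma_k$. A language $K\subseteq(\Sigma_1\cup\Sigma_2)^*$ is conditionally decomposable with respect to $\Sigma_1,\Sigma_2,\Sigma_k$ if $K=P_{1+k}(K)\parallel P_{2+k}(K)$. A language $M$ is controllable with respect to a prefix-closed language $L$ and a set of uncontrollable events $\Sigma'_u$ if $\overline{M}\Sigma'_u\cap L\subseteq\overline{M}$. $\sup C(K,L,\Sigma'_u)$ denotes the supremal controllable sublanguage of $K$: the union (which is itself controllable) of all $M\subseteq K\cap L$ controllable with respect to $L$ and $\Sigma'_u$. A language $M\subseteq L_m(G_1\|G_2\|G_k)$ is conditionally controllable with respect to $G_1,G_2,G_k$ and $\Sigma_{1,u},\Sigma_{2,u},\Sigma_{k,u}$ if (1) $P_k(M)$ is controllable with respect to $L(G_k)$ and $\Sigma_{k,u}$; (2) for $i=1,2$, $P_{i+k}(M)$ is controllable with respect to $L(G_i)\parallel\overline{P_k(M)}$ and $\Sigma_{i+k,u}$. $\sup cC(K,L,(\Sigma_{1,u},\Sigma_{2,u},\Sigma_{k,u}))$ is the supremal conditionally controllable sublanguage of $K$, i.e. the union (which is itself conditionally controllable) of all conditionally controllable $M\subseteq K$. Let $P:\Sigma^*\to\Sigma_0^*$ be a projection, $\Sigma_0\subseteq\Sigma$.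 Observer: $P$ is an $L$-observer for $L\subseteq\Sigma^*$ if for all $t\in P(L)$ and $s\in\overline{L}$, if $P(s)$ is a prefix of $t$ then there is $u\in\Sigma^*$ with $su\in L$ and $P(su)=t$. OCC (output control consistent): $P$ is OCC for $L\subseteq\Sigma^*$ if for every $s\in\overline{L}$ of the form $s=\sigma_1\cdots\sigma_\ell$ or $s=s'\sigma_0\sigma_1\cdots\sigma_\ell$, $\ell\ge1$, where $s'\in\Sigma^*$, $\sigma_0,\sigma_\ell\in\Sigma_0$ and $\sigma_i\in\Sigma\setminus\Sigma_0$ for $i=1,\dots,\ell-1$: if $\sigma_\ell\in\Sigma_u$, then $\sigma_i\in\Sigma_u$ for all $i=1,\dots,\ell-1$. LCC (locally control consistent): for a prefix-closed $L\subseteq\Sigma^*$, $P$ is LCC with respect to a word $s\in L$ if for all $\sigma_u\in\Sigma_0\cap\Sigma_u$ with $P(s)\sigma_u\in P(L)$, either there is no $u\in(\Sigma\setminus\Sigma_0)^*$ with $su\sigma_u\in L$, or there is $u\in(\Sigma_u\setminus\Sigma_0)^*$ with $su\sigma_u\in L$; $P$ is LCC for $L$ if it is LCC with respect to every $s\in L$. *)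

(* Defs.v *)
(* All words are words over one finite type [E] of events, and event sets are
   sets [A : {set E}].  A language over [A] is a [set (seq E)] all of whose
   words satisfy [word_over A]; operations that depend on the event sets of their
   arguments (such as the parallel composition) take these sets explicitly. *)
From HB Require Import structures.
From mathcomp Require Import all_boot.
From mathcomp Require Import boolp classical_sets.

Set Implicit Arguments.
Unset Strict Implicit.
Unset Printing Implicit Defensive.

Local Open Scope classical_set_scope.

Section Languages.
Variable E : finType.
Implicit Types (A Ak Au : {set E}) (s t u w : seq E) (K L M : set (seq E)).

Definition word_over A w : bool := all (mem A) w.

Definition prefix_closure L : set (seq E) :=
  [set s | exists2 t, L t & prefix s t].

Definition proj A w : seq E := [seq e <- w | e \in A].

Definition proj_lang A L : set (seq E) := proj A @` L.

(* Inverse image of [L] under the projection from words over [A] to words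
   over [A0]. *)
Definition inv_proj A A0 L : set (seq E) :=
  [set w | word_over A w /\ L (proj A0 w)].

Definition par_lang A1 A2 L1 L2 : set (seq E) :=
  [set w | [/\ word_over (A1 :|: A2) w, L1 (proj A1 w) & L2 (proj A2 w)]].

Definition nonconflicting A1 A2 L1 L2 : Prop :=
  prefix_closure (par_lang A1 A2 L1 L2) =
  par_lang A1 A2 (prefix_closure L1) (prefix_closure L2).

Definition cond_decomposable A1 A2 Ak K : Prop :=
  K = par_lang (A1 :|: Ak) (A2 :|: Ak)
        (proj_lang (A1 :|: Ak) K) (proj_lang (A2 :|: Ak) K).

(* [L] is meant to be prefix-closed. *)
Definition controllable M L Au : Prop :=
  forall s e, prefix_closure M s -> e \in Au -> L (rcons s e) ->
    prefix_closure M (rcons s e).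

Definition supC K L Au : set (seq E) :=
  \bigcup_(M in [set M | M `<=` K `&` L /\ controllable M L Au]) M.

(* In the next four definitions the projection goes from words over [A] to
   words over [A0], with [A0 \subset A], and [L] is a language over [A]. *)
Definition observer A A0 L : Prop :=
  forall t s, proj_lang A0 L t -> prefix_closure L s -> prefix (proj A0 s) t ->
    exists u, [/\ word_over A u, L (s ++ u) & proj A0 (s ++ u) = t].

(* [w] is sigma_1 ... sigma_(l-1) and [e] is sigma_l. *)
Definition occ A A0 Au L : Prop :=
  forall s w e, prefix_closure L s ->
    (s = rcons w e \/
     exists s' e0, [/\ word_over A s', e0 \in A0 & s = s' ++ e0 :: rcons w e]) ->
    e \in A0 -> word_over (A :\: A0) w -> e \in Au -> word_over Au w.

Definition lcc_at A A0 Au L s : Prop :=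
  forall e, e \in A0 :&: Au -> proj_lang A0 L (rcons (proj A0 s) e) ->
    ~ (exists2 u, word_over (A :\: A0) u & L (s ++ rcons u e)) \/
    (exists2 u, word_over (Au :\: A0) u & L (s ++ rcons u e)).

Definition lcc A A0 Au L : Prop := forall s, L s -> lcc_at A A0 Au L s.

End Languages.

(* The transition function is given on all of [E] and is undefined outside
   the event set [A]. *)
Record generator (E : finType) (A : {set E}) := Generator {
  state : finType;
  trans : state -> E -> option state;
  init : state;
  marked : {set state};
  trans_over : forall q e, isSome (trans q e) -> e \in A
}.
Arguments trans {E A} g q e.
Arguments init {E A} g.
Arguments marked {E A} g.

Section Generators.
Variable E : finType.

Fixpoint run (A : {set E}) (G : generator A) (q : state G) (w : seq E) :
    option (state G) :=
  if w is e :: w' then obind (fun q' => run q' w') (trans G q e) else Some q.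
Arguments run {A} G q w.

Definition gen_lang (A : {set E}) (G : generator A) : set (seq E) :=
  [set w | isSome (run G (init G) w)].

Definition marked_lang (A : {set E}) (G : generator A) : set (seq E) :=
  [set w | exists2 q, run G (init G) w = Some q & q \in marked G].

Definition regular (A : {set E}) (K : set (seq E)) : Prop :=
  exists G : generator A, marked_lang G = K.

Variables (A1 A2 : {set E}) (G1 : generator A1) (G2 : generator A2).

Definition par_trans (q : state G1 * state G2) (e : E) :
    option (state G1 * state G2) :=
  match e \in A1, e \in A2 with
  | true, true =>
      obind (fun q1 => omap (fun q2 => (q1, q2)) (trans G2 q.2 e))
            (trans G1 q.1 e)
  | true, false => omap (fun q1 => (q1, q.2)) (trans G1 q.1 e)
  | false, true => omap (fun q2 => (q.1, q2)) (trans G2 q.2 e)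
  | false, false => None
  end.

Lemma par_trans_over q e : isSome (par_trans q e) -> e \in A1 :|: A2.
Proof. by rewrite /par_trans inE; case: (e \in A1); case: (e \in A2). Qed.

Definition par_gen : generator (A1 :|: A2) :=
  @Generator E (A1 :|: A2) (state G1 * state G2)%type par_trans
    (init G1, init G2) (finset.setX (marked G1) (marked G2)) par_trans_over.

End Generators.
Arguments run {E A} G q w.

Section ConditionalControllability.
Variables (E : finType) (A1 A2 Ak : {set E}).
Variables (G1 : generator A1) (G2 : generator A2) (Gk : generator Ak).
Variable Au : {set E}.

Definition cond_controllable (M : set (seq E)) : Prop :=
  [/\ M `<=` marked_lang (par_gen (par_gen G1 G2) Gk),
      controllable (proj_lang Ak M) (gen_lang Gk) (Ak :&: Au),
      controllable (proj_lang (A1 :|: Ak) M)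
        (par_lang A1 Ak (gen_lang G1) (prefix_closure (proj_lang Ak M)))
        ((A1 :|: Ak) :&: Au)
    & controllable (proj_lang (A2 :|: Ak) M)
        (par_lang A2 Ak (gen_lang G2) (prefix_closure (proj_lang Ak M)))
        ((A2 :|: Ak) :&: Au)].

Definition supcC (K : set (seq E)) : set (seq E) :=
  \bigcup_(M in [set M | M `<=` K /\ cond_controllable M]) M.

End ConditionalControllability.

(* Main.v *)
Require Import Defs.
From HB Require Import structures.
From mathcomp Require Import all_boot.
From mathcomp Require Import boolp classical_sets.

Local Open Scope classical_set_scope.

(** Write [B1], [B2] for [A1 :|: Ak], [A2 :|: Ak], write [Sk], [S1], [S2] for the
    three supremal controllable languages and [M] for the parallel composition
    of [S1] and [S2].

    The language [M] contains every conditionally controllable sublanguage [N]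
    of [K].  The coordinator part of [N] is controllable, hence included in
    [Sk].  The local parts of [N] are controllable with respect to the plants
    restricted by the coordinator part of [N]; since that part is itself
    controllable, they remain controllable when the plants are only restricted
    by [Sk] ([controllable_relax]), hence they are included in [S1] and [S2].

    Conversely [M] is a sublanguage of [K] by conditional decomposability, and
    it has to be shown conditionally controllable.  By nonconflictingness, a word
    is a prefix of a word of [M] as soon as its two local projections are
    prefixes of words of [S1] and [S2].  Suppose that the coordinator allows an
    uncontrollable event [e] of [Ak] after the projection of a prefix [s] of [M].
    Then [e] is also possible, seen from [Ak], in both local plants; the observer
    property provides silent words after which the plants really execute [e],
    and OCC or LCC makes these words uncontrollable ([uncontrollable_path]).
    Controllability of [S1] and [S2] then keeps the extended words inside
    their prefix closures ([controllable_lifts]).  The silent words of the two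
    components consist of private events, so they do not interact, and the
    extensions combine into a prefix of [M].  This gives controllability of the
    coordinator part ([proj_par_controllable]); the local parts are treated in
    the same way, with a silent word needed in the other component only
    ([local_par_controllable]). *)

Set Implicit Arguments.
Unset Strict Implicit.
Unset Printing Implicit Defensive.

(** * Words and projections *)

Section Words.
Variable E : finType.
Implicit Types (A B C : {set E}) (s t u v w x : seq E) (e : E).
Implicit Types (L M : set (seq E)).

Lemma proj_cat A s t : proj A (s ++ t) = proj A s ++ proj A t.
Proof. exact: filter_cat. Qed.

Lemma proj_rcons A s e :
  proj A (rcons s e) = if e \in A then rcons (proj A s) e else proj A s.
Proof. exact: filter_rcons. Qed.

Lemma word_over_proj A w : word_over A (proj A w).
Proof. by apply/allP => e; rewrite mem_filter => /andP[]. Qed.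

Lemma proj_id A w : word_over A w -> proj A w = w.
Proof. by move/all_filterP. Qed.

Lemma proj_proj A B w : A \subset B -> proj A (proj B w) = proj A w.
Proof.
move=> /fintype.subsetP sAB; rewrite /proj -filter_predI; apply: eq_filter => e /=.
by case: (boolP (e \in A)) => // /sAB.
Qed.

Lemma proj_projI A B w : proj A (proj B w) = proj (A :&: B) w.
Proof. by rewrite /proj -filter_predI; apply: eq_filter => e /=; rewrite inE. Qed.

Lemma proj_erased A B w : word_over (B :\: A) w -> proj A w = [::].
Proof.
move=> /allP wB; apply/eqP; rewrite -size_eq0 size_filter -leqn0 leqNgt -has_count.
by apply/hasPn => e /wB; rewrite /= inE => /andP[].
Qed.

Lemma sub_word_over A B w : A \subset B -> word_over A w -> word_over B w.
Proof. by move=> /fintype.subsetP sAB; apply: sub_all => e /sAB. Qed.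

Lemma word_over_cat A s t : word_over A (s ++ t) = word_over A s && word_over A t.
Proof. exact: all_cat. Qed.

Lemma word_over_rcons A s e : word_over A (rcons s e) = (e \in A) && word_over A s.
Proof. exact: all_rcons. Qed.

Lemma proj_prefix A s t : prefix s t -> prefix (proj A s) (proj A t).
Proof. by move=> /prefixP[u ->]; rewrite proj_cat prefix_prefix. Qed.

Lemma prefix_proj_lift A x t :
  prefix x (proj A t) -> exists2 s, prefix s t & proj A s = x.
Proof.
elim: t x => [|a t IH] x.
  by rewrite prefixs0 => /eqP ->; exists [::].
rewrite [proj A _]/=; case: (boolP (a \in A)) => aA.
  case: x => [|b x]; first by exists [::].
  rewrite prefix_cons => /andP[/eqP -> /IH[s st <-]].
  by exists (a :: s); rewrite ?prefix_cons ?eqxx //= aA.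
by move=> /IH[s st <-]; exists (a :: s); rewrite ?prefix_cons ?eqxx //= (negbTE aA).
Qed.

(** Two words over overlapping event sets that agree on the shared events can
    be interleaved: the synchronized events are matched, all others are
    shuffled freely. *)
Lemma synchronize A B v x : word_over A v -> word_over B x ->
  proj B v = proj A x ->
  exists w, [/\ word_over (A :|: B) w, proj A w = v & proj B w = x].
Proof.
elim: v x => [|a v IHv] x.
  move=> _ xB /esym vx; exists x; split=> //; last exact: proj_id.
  by apply: sub_word_over xB; apply: finset.subsetUr.
move=> /= /andP[aA vA].
case: (boolP (a \in B)) => aB.
  elim: x => [|b x IHx] //= /andP[bB xB].
  case: (boolP (b \in A)) => bA.
    move=> [<- vx]; have [w [wAB wv wx]] := IHv _ vA xB vx.
    by exists (a :: w); rewrite /= inE aA aB wAB wv wx.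
  move=> /(IHx xB) [w [wAB wv wx]].
  by exists (b :: w); rewrite /= inE bB orbT (negbTE bA) wAB wv wx.
move=> xB /(IHv _ vA xB) [w [wAB wv wx]].
by exists (a :: w); rewrite /= inE aA (negbTE aB) wAB wv wx.
Qed.

Lemma split_last_event A B s : word_over A s ->
  word_over (A :\: B) s \/
  exists s' e v, [/\ word_over A s', e \in B, word_over (A :\: B) v
                   & s = s' ++ e :: v].
Proof.
elim/last_ind: s => [|s a IH]; first by left.
rewrite word_over_rcons => /andP[aA sA].
case: (boolP (a \in B)) => aB; first by right; exists s, a, [::]; rewrite cats1.
case: (IH sA) => [sAB|[s' [e [v [s'A eB vAB ->]]]]].
  by left; rewrite word_over_rcons inE aB aA.
right; exists s', e, (rcons v a); split=> //; last by rewrite rcons_cat.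
by rewrite word_over_rcons inE aB aA.
Qed.

Lemma proj_rcons_factor A s u e :
  proj A (s ++ u) = rcons (proj A s) e ->
  exists v t, [/\ u = rcons v e ++ t, e \in A & proj A v = [::]].
Proof.
rewrite proj_cat -cats1 => /eqP; rewrite eqseq_cat // eqxx /= => /eqP.
elim: u => //= a u IH; case: (boolP (a \in A)) => aA.
  by move=> [<- _]; exists [::], u.
move=> /IH[v [t [-> eA vA]]]; exists (a :: v), t.
by rewrite /= (negbTE aA).
Qed.

Lemma proj_private B1 B2 C s u : B1 :&: B2 \subset C ->
  word_over (B2 :\: C) u -> proj B1 (s ++ u) = proj B1 s.
Proof.
move=> B12k uk; rewrite proj_cat (@proj_erased B1 B2 u) ?cats0 //.
apply: sub_word_over uk; apply/fintype.subsetP => e; rewrite !inE => /andP[ek e2].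
rewrite e2 andbT; apply: contra ek => e1.
by apply: (fintype.subsetP B12k); rewrite inE e1.
Qed.

Lemma erased_word_over A B v :
  word_over A v -> proj B v = [::] -> word_over (A :\: B) v.
Proof.
move=> vA /eqP; rewrite -size_eq0 size_filter eqn0Ngt -has_count => /hasPn vB.
by apply/allP => e ev; rewrite /= inE (vB _ ev) (allP vA _ ev : e \in A).
Qed.

(** * Languages, prefix closures and controllability *)

Definition prefix_closed L : Prop := prefix_closure L `<=` L.

Lemma sub_prefix_closure L : L `<=` prefix_closure L.
Proof. by move=> s Ls; exists s => //; apply: prefix_refl. Qed.

Lemma prefix_closure_closed L : prefix_closed (prefix_closure L).
Proof. by move=> s [t [t' Lt' tt'] st]; exists t' => //; apply: prefix_trans tt'. Qed.

Lemma closed_prefix L s t : prefix_closed L -> L t -> prefix s t -> L s.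
Proof. by move=> clL Lt st; apply: clL; exists t. Qed.

Lemma prefix_closure_min L M :
  prefix_closed M -> L `<=` M -> prefix_closure L `<=` M.
Proof. by move=> clM LM s [t /LM Mt] st; apply: closed_prefix st. Qed.

Lemma prefix_closure_proj A L :
  prefix_closure (proj_lang A L) = proj_lang A (prefix_closure L).
Proof.
apply/seteqP; split=> [x [_ [t Lt <-]] /prefix_proj_lift[s st <-]|_ [s [t Lt st] <-]].
  by exists s => //; exists t.
by exists (proj A t); [exists t | apply: proj_prefix].
Qed.

Lemma par_lang_closed A B L M :
  prefix_closed L -> prefix_closed M -> prefix_closed (par_lang A B L M).
Proof.
move=> clL clM s [t [tAB Lt Mt] st]; split.
- by move/prefixP: st tAB => [u ->]; rewrite word_over_cat => /andP[].
- by apply: closed_prefix Lt _ => //; apply: proj_prefix.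
- by apply: closed_prefix Mt _ => //; apply: proj_prefix.
Qed.

Lemma inv_proj_closed A B L : prefix_closed L -> prefix_closed (inv_proj A B L).
Proof.
move=> clL s [t [tA Lt] st]; split.
  by move/prefixP: st tA => [u ->]; rewrite word_over_cat => /andP[].
by apply: closed_prefix Lt _ => //; apply: proj_prefix.
Qed.

Lemma par_langC A B L M : par_lang A B L M = par_lang B A M L.
Proof. by apply/seteqP; split=> w []; rewrite finset.setUC. Qed.

Lemma nonconflictingC A B L M :
  nonconflicting A B L M -> nonconflicting B A M L.
Proof. by rewrite /nonconflicting (par_langC B A M L) => ->; rewrite par_langC. Qed.

Lemma supC_sub K L Au : supC K L Au `<=` K `&` L.
Proof. by move=> s [M [MKL _] Ms]; apply: MKL. Qed.

Lemma sub_supC M K L Au :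
  M `<=` K `&` L -> controllable M L Au -> M `<=` supC K L Au.
Proof. by move=> MKL Mc s Ms; exists M. Qed.

Lemma supC_controllable K L Au : controllable (supC K L Au) L Au.
Proof.
move=> s e [t [M [MKL Mc] Mt] st] eAu Lse.
have [|t' Mt' set'] := Mc s e _ eAu Lse; first by exists t.
by exists t' => //; exists M.
Qed.

Lemma supC_closure_sub K L Au :
  prefix_closed L -> prefix_closure (supC K L Au) `<=` L.
Proof.
by move=> clL; apply: prefix_closure_min => // s Ss; have [] := supC_sub Ss.
Qed.

Lemma controllable_cat M L Au s u : prefix_closed L -> controllable M L Au ->
  prefix_closure M s -> word_over Au u -> L (s ++ u) -> prefix_closure M (s ++ u).
Proof.
move=> clL Mc Ms; elim/last_ind: u => [|u e IH]; first by rewrite cats0.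
rewrite word_over_rcons -rcons_cat => /andP[eAu uAu] Lsue.
apply: Mc => //; apply: IH => //.
by apply: closed_prefix Lsue _ => //; apply: prefix_rcons.
Qed.

End Words.

(** * Languages of generators *)

Section GeneratorLanguages.
Variable E : finType.

Lemma run_over (A : {set E}) (G : generator A) q w :
  isSome (run G q w) -> word_over A w.
Proof.
elim: w q => //= e w IH q.
case: (trans G q e) (@trans_over _ _ G q e) => //= q' -> //.
exact: IH.
Qed.

Lemma gen_lang_over (A : {set E}) (G : generator A) w :
  gen_lang G w -> word_over A w.
Proof. exact: run_over. Qed.

Lemma run_cat (A : {set E}) (G : generator A) q s t :
  run G q (s ++ t) = obind (fun q' => run G q' t) (run G q s).
Proof. by elim: s q => //= e s IH q; case: (trans G q e) => /=. Qed.

Lemma gen_lang_closed (A : {set E}) (G : generator A) : prefix_closed (gen_lang G).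
Proof.
move=> s [t + /prefixP[u tE]]; rewrite /gen_lang /= tE run_cat.
by case: (run _ _ s).
Qed.

Lemma marked_gen_lang (A : {set E}) (G : generator A) :
  marked_lang G `<=` gen_lang G.
Proof. by move=> w [q wq _]; rewrite /gen_lang /= wq. Qed.

Lemma par_run (A1 A2 : {set E}) (G1 : generator A1) (G2 : generator A2) q w :
  isSome (run (par_gen G1 G2) q w) ->
  isSome (run G1 q.1 (proj A1 w)) /\ isSome (run G2 q.2 (proj A2 w)).
Proof.
elim: w q => //= e w IH q; rewrite /par_trans.
case: (e \in A1) => /=; case: (e \in A2) => //=.
- by case: (trans G1 _ e) => //= q1; case: (trans G2 _ e) => //= q2 /IH.
- by case: (trans G1 _ e) => //= q1 /IH.
- by case: (trans G2 _ e) => //= q2 /IH.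
Qed.

Lemma par_gen_lang (A1 A2 : {set E}) (G1 : generator A1) (G2 : generator A2) w :
  gen_lang (par_gen G1 G2) w ->
  gen_lang G1 (proj A1 w) /\ gen_lang G2 (proj A2 w).
Proof. exact: par_run. Qed.

End GeneratorLanguages.

(** * Lifting uncontrollable coordinator events to the local plants *)

Section Lifting.
Variable E : finType.
Implicit Types (A B Ak Au : {set E}) (s u x : seq E) (e : E).

(** A pointwise form of the statement that the projection to [Ak] of the prefix
    closure of [S] is controllable with respect to [Lk].  Fixing the word [s]
    rather than just its projection is what allows the words obtained for two
    components to be glued back together. *)
Definition lifts_uncontrollable B Ak Au (S Lk : set (seq E)) : Prop :=
  forall s e, prefix_closure S s -> e \in Ak :&: Au ->
    Lk (rcons (proj Ak s) e) ->
    exists2 u, word_over (B :\: Ak) u & prefix_closure S (rcons (s ++ u) e).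

(** The observer property provides a continuation of [s], which may go
    on after [e]; cutting it at its first observable event leaves a silent word
    followed by [e]. *)
Lemma observer_event B Ak L s e : prefix_closed L ->
  observer B Ak L -> L s -> proj_lang Ak L (rcons (proj Ak s) e) ->
  exists2 u, word_over (B :\: Ak) u & L (rcons (s ++ u) e).
Proof.
move=> clL obs Ls Lxe.
have [|u [uB Lsu]] := obs _ s Lxe (sub_prefix_closure Ls).
  exact: prefix_rcons.
move=> /proj_rcons_factor[v [t [uE eAk vk]]]; exists v.
  apply: erased_word_over vk; move: uB.
  by rewrite uE word_over_cat word_over_rcons => /andP[/andP[]].
by apply: closed_prefix Lsu _ => //; rewrite uE catA rcons_cat prefix_prefix.
Qed.

(** Both consistency conditions serve the same purpose: they make the silent
    word that precedes an uncontrollable observable event uncontrollable.  OCC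
    says this of every such word, LCC supplies one. *)
Lemma uncontrollable_path B Ak Au L s e : prefix_closed L ->
  (forall w, L w -> word_over B w) -> observer B Ak L ->
  occ B Ak Au L \/ lcc B Ak Au L ->
  L s -> e \in Ak :&: Au -> proj_lang Ak L (rcons (proj Ak s) e) ->
  exists2 u, word_over (Au :\: Ak) u & L (rcons (s ++ u) e).
Proof.
move=> clL LB obs cons Ls eku Lxe.
have [u uBk Lsue] := observer_event clL obs Ls Lxe.
case: cons => [Hocc|/(_ s Ls e eku Lxe)[[]|[v vu Lsve]]]; last 2 first.
- by exists u => //; rewrite -rcons_cat.
- by exists v => //; rewrite rcons_cat.
have /finset.setIP[ek eu] := eku.
have uku : word_over Au u -> word_over (Au :\: Ak) u.
  move=> uAu; apply/allP => a au; move/allP/(_ _ au): uBk => /=.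
  by rewrite !inE (allP uAu _ au : a \in Au) andbT => /andP[].
exists u => //; apply: uku.
have Hsue := sub_prefix_closure Lsue.
(* OCC speaks of the whole silent block since the last observable event, part
   of which may already belong to [s]. *)
case: (split_last_event Ak (LB _ Ls)) => [sBk|[s' [a [v [s'B aAk vBk sE]]]]].
  have := Hocc _ (s ++ u) e Hsue (or_introl (erefl _)) ek _ eu.
  by rewrite !word_over_cat sBk uBk => /(_ isT)/andP[].
have := Hocc _ (v ++ u) e Hsue _ ek _ eu.
rewrite !word_over_cat vBk uBk => H.
suff /H/(_ isT)/andP[] : rcons (s ++ u) e = rcons (v ++ u) e \/
    exists s' a, [/\ word_over B s', a \in Ak
                   & rcons (s ++ u) e = s' ++ a :: rcons (v ++ u) e] by [].
by right; exists s', a; split=> //; rewrite sE -catA rcons_cat.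
Qed.

(** A coordinator word whose shared part is possible in the plant is the
    projection of a word of the lifted plant. *)
Lemma proj_inv_proj A Ak L x : (forall w, L w -> word_over A w) ->
  word_over Ak x -> proj_lang Ak L (proj (A :&: Ak) x) ->
  proj_lang Ak (inv_proj (A :|: Ak) A L) x.
Proof.
move=> LA xk [v Lv vx].
have [|w [wAk wv wx]] := synchronize (LA _ Lv) xk.
  by rewrite vx -proj_projI (proj_id xk).
by exists w => //; split; rewrite ?wv.
Qed.

(** From a word [s] of [S], the plant reaches the coordinator event by silent
    uncontrollable steps; none of them is seen by the coordinator, hence the
    path stays within the plant restricted by [Sk], and controllability of [S]
    keeps it inside the closure of [S]. *)
Lemma controllable_lifts A Ak Au (L Lk Sk S : set (seq E)) :
  prefix_closed L -> (forall w, L w -> word_over A w) ->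
  (forall w, Lk w -> word_over Ak w) ->
  (forall w, Lk w -> proj_lang Ak L (proj (A :&: Ak) w)) ->
  let B := A :|: Ak in
  let I := inv_proj B A L in
  observer B Ak I -> occ B Ak Au I \/ lcc B Ak Au I ->
  controllable Sk Lk (Ak :&: Au) ->
  let P := par_lang A Ak L (prefix_closure Sk) in
  S `<=` P -> controllable S P (B :&: Au) ->
  lifts_uncontrollable B Ak Au S Lk.
Proof.
move=> clL LA LkAk LkL B I obs cons Skc P SP Sc s e Ss eku Lkxe.
have clP : prefix_closed P by apply: par_lang_closed => //; apply: prefix_closure_closed.
have [sB Ls Sks] := prefix_closure_min clP SP Ss.
have /finset.setIP[ek eu] := eku.
have [|||||u uu [sueB Lsue]] := @uncontrollable_path B Ak Au I s e _ _ obs cons.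
- exact: inv_proj_closed.
- by move=> w [].
- by [].
- by [].
- by apply: proj_inv_proj => //; [apply: LkAk | apply: LkL].
have uk : proj Ak u = [::].
  exact: proj_erased uu.
have uB : word_over B u.
  by move: sueB; rewrite word_over_rcons word_over_cat => /and3P[].
exists u; first exact: erased_word_over.
rewrite rcons_cat; apply: (controllable_cat clP Sc) => //.
  rewrite word_over_rcons !inE ek eu orbT /=.
  apply/allP => a au; rewrite /= inE (allP uB _ au : a \in B) /=.
  by have := allP uu _ au; rewrite /= inE => /andP[].
rewrite -rcons_cat; split=> //.
by rewrite proj_rcons ek proj_cat uk cats0; apply: Skc.
Qed.

End Lifting.

(** * Composing the local supervisors *)

Section Composition.
Variables (E : finType) (B1 B2 Ak Au : {set E}).
Variables (S1 S2 Lk : set (seq E)).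
Hypothesis B12k : B1 :&: B2 \subset Ak.
Hypotheses (kB1 : Ak \subset B1) (kB2 : Ak \subset B2).
Hypothesis S12 : nonconflicting B1 B2 S1 S2.
Let M := par_lang B1 B2 S1 S2.

Lemma closure_par s : prefix_closure M s <->
  [/\ word_over (B1 :|: B2) s, prefix_closure S1 (proj B1 s)
    & prefix_closure S2 (proj B2 s)].
Proof. by rewrite /M S12. Qed.

(** The two silent words use private events of different components, so they
    can be concatenated; nonconflictingness turns the result, which is only
    known to be a prefix in each component, into a prefix of [M]. *)
Lemma proj_par_controllable :
  lifts_uncontrollable B1 Ak Au S1 Lk -> lifts_uncontrollable B2 Ak Au S2 Lk ->
  controllable (proj_lang Ak M) Lk (Ak :&: Au).
Proof.
move=> l1 l2 x e; rewrite prefix_closure_proj => -[s Ms <-] eku Lkxe.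
have /finset.setIP[ek eu] := eku.
have /closure_par[sB s1 s2] := Ms.
have [|u1 u1k Su1] := l1 _ e s1 eku; first by rewrite proj_proj.
have [|u2 u2k Su2] := l2 _ e s2 eku; first by rewrite proj_proj.
have e1 := fintype.subsetP kB1 _ ek; have e2 := fintype.subsetP kB2 _ ek.
have p1 : proj B1 (s ++ u1 ++ u2) = proj B1 s ++ u1.
  rewrite catA (proj_private _ B12k) // proj_cat (@proj_id _ B1 u1) //.
  by apply: sub_word_over u1k; apply: finset.subsetDl.
have p2 : proj B2 (s ++ u1 ++ u2) = proj B2 s ++ u2.
  rewrite catA proj_cat (@proj_private _ B2 B1 Ak s u1) //; last by rewrite finset.setIC.
  by rewrite (@proj_id _ B2 u2) //; apply: sub_word_over u2k; apply: finset.subsetDl.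
exists (rcons (s ++ u1 ++ u2) e).
  apply/closure_par; split.
  - rewrite word_over_rcons inE e1 !word_over_cat sB /=.
    apply/andP; split; [apply: sub_word_over u1k | apply: sub_word_over u2k].
      by apply: fintype.subset_trans (finset.subsetDl _ _) (finset.subsetUl _ _).
    by apply: fintype.subset_trans (finset.subsetDl _ _) (finset.subsetUr _ _).
  - by rewrite proj_rcons e1 p1.
  - by rewrite proj_rcons e2 p2.
rewrite proj_rcons ek -(@proj_proj _ Ak B1) // p1 proj_cat proj_proj //.
by rewrite (proj_erased u1k) cats0.
Qed.

(** A private event of the first component is invisible to the second one; a
    coordinator event can be executed by the second one after a silent word.
    Either way the first component sees just that event, and controllability
    of [S1] applies to it. *)
Lemma local_par_controllable A1 L1 Sk :
  lifts_uncontrollable B2 Ak Au S2 Lk ->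
  prefix_closure Sk `<=` Lk ->
  prefix_closure (proj_lang Ak M) `<=` prefix_closure Sk ->
  controllable S1 (par_lang A1 Ak L1 (prefix_closure Sk)) (B1 :&: Au) ->
  controllable (proj_lang B1 M)
    (par_lang A1 Ak L1 (prefix_closure (proj_lang Ak M))) (B1 :&: Au).
Proof.
move=> l2 SkL MSk S1c a e; rewrite prefix_closure_proj => -[s Ms <-] e1u.
move=> [seA Lse Mse].
have /finset.setIP[e1 eu] := e1u.
have /closure_par[sB s1 s2] := Ms.
have s1e : prefix_closure S1 (rcons (proj B1 s) e).
  by apply: S1c => //; split=> //; apply: MSk.
case: (boolP (e \in Ak)) => ek; last first.
  have e2 : e \notin B2.
    by apply: contra ek => e2; apply: (fintype.subsetP B12k); rewrite inE e1.
  exists (rcons s e); last by rewrite proj_rcons e1.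
  apply/closure_par; split.
  - by rewrite word_over_rcons inE e1.
  - by rewrite proj_rcons e1.
  - by rewrite proj_rcons (negbTE e2).
have e2 := fintype.subsetP kB2 _ ek.
have [||u uk Su] := l2 _ e s2; first by rewrite inE ek.
  by rewrite proj_proj //; apply/SkL/MSk; move: Mse; rewrite proj_rcons ek proj_proj.
have p1 : proj B1 (rcons (s ++ u) e) = rcons (proj B1 s) e.
  by rewrite proj_rcons e1 (proj_private _ B12k).
exists (rcons (s ++ u) e) => //; apply/closure_par; split.
- rewrite word_over_rcons inE e1 word_over_cat sB /=.
  apply: sub_word_over uk.
  exact: fintype.subset_trans (finset.subsetDl _ _) (finset.subsetUr _ _).
- by rewrite p1.
- rewrite proj_rcons e2 proj_cat (@proj_id _ B2 u) //.
  by apply: sub_word_over uk; apply: finset.subsetDl.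
Qed.

End Composition.

(** Controllability is transitive: the coordinator part of [M] is controllable
    within [Sk], hence the local part of [M], controllable with the coordinator
    restricted to [M], stays so when the coordinator is only restricted to
    [Sk]. *)
Lemma controllable_relax (E : finType) (A Ak Au : {set E})
    (L Lk Sk M : set (seq E)) : let B := A :|: Ak in
  prefix_closure Sk `<=` Lk ->
  controllable (proj_lang Ak M) Lk (Ak :&: Au) ->
  controllable (proj_lang B M)
    (par_lang A Ak L (prefix_closure (proj_lang Ak M))) (B :&: Au) ->
  controllable (proj_lang B M) (par_lang A Ak L (prefix_closure Sk)) (B :&: Au).
Proof.
move=> B SkL Mkc Mc a e Ma eBu [aeA Lae Sae].
apply: Mc => //; split=> //.
have /finset.setIP[_ eu] := eBu.
have Mka : prefix_closure (proj_lang Ak M) (proj Ak a).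
  move: Ma; rewrite !prefix_closure_proj => -[s Ms <-].
  by exists s => //; rewrite proj_proj //; apply: finset.subsetUr.
move: Sae; rewrite proj_rcons; case: ifP => // ek /SkL Lke.
by apply: Mkc => //; rewrite inE ek.
Qed.

(** * The supremal conditionally controllable sublanguage *)

Theorem theorem11 (E : finType) (A1 A2 Ak Ac Au : {set E})
    (A1_neq0 : A1 != finset.set0) (A2_neq0 : A2 != finset.set0)
    (Ak_neq0 : Ak != finset.set0)
    (G1 : generator A1) (G2 : generator A2) (Gk : generator Ak)
    (cu_cover : Ac :|: Au = A1 :|: A2) (cu_disjoint : Ac :&: Au = finset.set0)
    (sub_k : A1 :&: A2 \subset Ak) (k_sub : Ak \subset A1 :|: A2)
    (Gk_sub : gen_lang Gk `<=`
       par_lang (A1 :&: Ak) (A2 :&: Ak)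
         (proj_lang Ak (gen_lang G1)) (proj_lang Ak (gen_lang G2)))
    (K : set (seq E)) (K_regular : regular (A1 :|: A2) K)
    (K_sub : K `<=` marked_lang (par_gen (par_gen G1 G2) Gk))
    (K_cd : cond_decomposable A1 A2 Ak K)
    (pK_cd : cond_decomposable A1 A2 Ak (prefix_closure K)) :
  let supCk := supC (proj_lang Ak K) (gen_lang Gk) (Ak :&: Au) in
  let supC1k := supC (proj_lang (A1 :|: Ak) K)
    (par_lang A1 Ak (gen_lang G1) (prefix_closure supCk))
    ((A1 :|: Ak) :&: Au) in
  let supC2k := supC (proj_lang (A2 :|: Ak) K)
    (par_lang A2 Ak (gen_lang G2) (prefix_closure supCk))
    ((A2 :|: Ak) :&: Au) in
  let I1 := inv_proj (A1 :|: Ak) A1 (gen_lang G1) in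
  let I2 := inv_proj (A2 :|: Ak) A2 (gen_lang G2) in
  nonconflicting (A1 :|: Ak) (A2 :|: Ak) supC1k supC2k ->
  observer (A1 :|: Ak) Ak I1 ->
  observer (A2 :|: Ak) Ak I2 ->
  (occ (A1 :|: Ak) Ak Au I1 /\ occ (A2 :|: Ak) Ak Au I2) \/
  (lcc (A1 :|: Ak) Ak Au I1 /\ lcc (A2 :|: Ak) Ak Au I2) ->
  par_lang (A1 :|: Ak) (A2 :|: Ak) supC1k supC2k = supcC G1 G2 Gk Au K.
Proof.
move=> supCk supC1k supC2k I1 I2 nonconf obs1 obs2 cons.
set B1 := A1 :|: Ak in supC1k nonconf obs1 cons *.
set B2 := A2 :|: Ak in supC2k nonconf obs2 cons *.
have cons1 : occ B1 Ak Au I1 \/ lcc B1 Ak Au I1.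
  by case: cons => -[c1 c2]; [left|right].
have cons2 : occ B2 Ak Au I2 \/ lcc B2 Ak Au I2.
  by case: cons => -[c1 c2]; [left|right].
have kB1 : Ak \subset B1 by apply: finset.subsetUr.
have kB2 : Ak \subset B2 by apply: finset.subsetUr.
have B12k : B1 :&: B2 \subset Ak by rewrite -finset.setUIl finset.subUset sub_k /=.
have B21k : B2 :&: B1 \subset Ak by rewrite finset.setIC.
have SkL : prefix_closure supCk `<=` gen_lang Gk.
  by apply: supC_closure_sub; apply: gen_lang_closed.
have supCk_c : controllable supCk (gen_lang Gk) (Ak :&: Au).
  exact: supC_controllable.
have S1P : supC1k `<=` par_lang A1 Ak (gen_lang G1) (prefix_closure supCk).
  by move=> s Ss; have [] := supC_sub Ss.
have S2P : supC2k `<=` par_lang A2 Ak (gen_lang G2) (prefix_closure supCk).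
  by move=> s Ss; have [] := supC_sub Ss.
have lift1 : lifts_uncontrollable B1 Ak Au supC1k (gen_lang Gk).
  apply: (controllable_lifts _ _ _ _ obs1 cons1 supCk_c S1P).
  - exact: gen_lang_closed.
  - exact: gen_lang_over.
  - exact: gen_lang_over.
  - by move=> w /Gk_sub[].
  - exact: supC_controllable.
have lift2 : lifts_uncontrollable B2 Ak Au supC2k (gen_lang Gk).
  apply: (controllable_lifts _ _ _ _ obs2 cons2 supCk_c S2P).
  - exact: gen_lang_closed.
  - exact: gen_lang_over.
  - exact: gen_lang_over.
  - by move=> w /Gk_sub[].
  - exact: supC_controllable.
apply/seteqP; split=> [w Mw|w [M [MK [ML Mkc M1c M2c]] Mw]].
  set M := par_lang B1 B2 supC1k supC2k in Mw.
  have MK : M `<=` K.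
    move=> s [sB s1 s2]; rewrite K_cd; split=> //.
      by have [] := supC_sub s1.
    by have [] := supC_sub s2.
  have MSk : prefix_closure (proj_lang Ak M) `<=` prefix_closure supCk.
    apply: prefix_closure_min; first exact: prefix_closure_closed.
    by move=> _ [s [_ /S1P[_ _ +] _] <-]; rewrite proj_proj.
  exists M => //; split=> //; split.
  - exact: subset_trans MK K_sub.
  - exact: proj_par_controllable.
  - apply: (local_par_controllable B12k kB1 kB2 nonconf lift2 SkL MSk).
    exact: supC_controllable.
  - rewrite /M (par_langC B1) in MSk *.
    apply: (local_par_controllable B21k kB2 kB1 (nonconflictingC nonconf)
              lift1 SkL MSk).
    exact: supC_controllable.
have MG s : M s ->
    [/\ gen_lang G1 (proj A1 s), gen_lang G2 (proj A2 s) & gen_lang Gk (proj Ak s)].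
  move=> /ML/marked_gen_lang/par_gen_lang[/par_gen_lang[g1 g2] gk].
  by rewrite !proj_proj ?finset.subsetUl ?finset.subsetUr in g1 g2; split.
have MSk : proj_lang Ak M `<=` supCk.
  apply: sub_supC => // _ [s Ms <-]; split; first by exists s => //; apply: MK.
  by have [] := MG _ Ms.
have M1 : proj_lang B1 M `<=` supC1k.
  apply: sub_supC; last exact: controllable_relax SkL Mkc M1c.
  move=> _ [s Ms <-]; split; first by exists s => //; apply: MK.
  have [g1 _ _] := MG _ Ms; split; first exact: word_over_proj.
    by rewrite proj_proj ?finset.subsetUl.
  by rewrite proj_proj //; apply/sub_prefix_closure/MSk; exists s.
have M2 : proj_lang B2 M `<=` supC2k.
  apply: sub_supC; last exact: controllable_relax SkL Mkc M2c.
  move=> _ [s Ms <-]; split; first by exists s => //; apply: MK.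
  have [_ g2 _] := MG _ Ms; split; first exact: word_over_proj.
    by rewrite proj_proj ?finset.subsetUl.
  by rewrite proj_proj //; apply/sub_prefix_closure/MSk; exists s.
(* The decomposition of [K] gives the event set of [w]. *)
have := MK _ Mw; rewrite [in X in X -> _]K_cd => -[wB _ _].
by split=> //; [apply: M1 | apply: M2]; exists w.
Qed.
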